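(* Let $\Psi:(0,\infty)\to(0,\infty)$ and suppose there exist functions $d,e:(0,\infty)\to(0,\infty)$ with $\Psi=d/e$ and $d(q),e(q)\in\mathbb{N}$ for all $q\in\mathbb{N}$. Then: (1) If $\omega:(0,\infty)\to(0,\infty)$ satisfies $$\omega(q)<\frac{1-\omega(qe(q))}{\Psi(q)}\Psi(qe(q))$$ for all $q$ sufficiently large, then $E(\Psi,\omega)=\emptyset$. (2) Assume moreover that $e(q)\equiv 0 \pmod q$ for all $q\in\mathbb{N}$. If $\omega:(0,\infty)\to(0,\infty)$ satisfies $$\omega(q)<\frac{1-\omega(e(q))}{\Psi(q)}\Psi(e(q))$$ for all $q$ sufficiently large, then $E(\Psi,\omega)=\emptyset$.
   Context: $W(\Psi)$ denotes the set of $x\in\mathbb{R}$ with $|x-p/q|\le\Psi(q)$ for infinitely many $(p,q)\in\mathbb{Z}\times\mathbb{N}$. For functions $\Psi,\omega$ on $(0,\infty)$, $E(\Psi,\omega)$ denotes the set of $x\in W(\Psi)$ such that for all $q\in\mathbb{N}$ sufficiently large, $|x-p/q|\ge(1-\omega(q))\Psi(q)$ for all $p\in\mathbb{Z}$. *)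

(* Defs.v *)
From HB Require Import structures.
From mathcomp Require Import all_boot all_order all_algebra.
From mathcomp Require Import all_classical all_reals all_analysis.
Set Implicit Arguments.
Unset Strict Implicit.
Unset Printing Implicit Defensive.
Import Order.TTheory GRing.Theory Num.Theory.
Import numFieldNormedType.Exports.
Local Open Scope classical_set_scope.
Local Open Scope ring_scope.

(* Functions (0, oo) -> (0, oo) are represented by functions R -> R that are
   positive at every positive point; values at nonpositive points are never
   used.  The set of natural numbers does not contain 0 here, whence the
   condition (0 < q)%N. *)
Definition pos_fun (R : realType) (f : R -> R) : Prop :=
  forall t : R, 0 < t -> 0 < f t.

(* The pairs (p, q) are not required to be coprime. *)
Definition approx_set (R : realType) (Psi : R -> R) : set R :=
  [set x | infinite_set [set pq : int * nat |
     (0 < pq.2)%N /\ `|x - pq.1%:~R / pq.2%:R| <= Psi pq.2%:R]].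

Definition exact_approx_set (R : realType) (Psi omega : R -> R) : set R :=
  [set x | approx_set Psi x /\
     \forall q \near \oo, forall p : int,
       (1 - omega q%:R) * Psi q%:R <= `|x - p%:~R / q%:R|].

(* Main.v *)
(* If [|x - p/q| <= Psi q], then the endpoint [P/Q] of [p/q +- Psi q] on the side
   of [x] is at distance [Psi q - |x - p/q|] from [x], which is at most
   [omega q * Psi q] when [x] is in [E(Psi, omega)].  As [Psi q = d/e] is rational,
   [Q] can be taken to be [q * e q], or [e q] if [q] divides [e q]; the hypothesis
   on [omega] then puts [P/Q] too close to [x]. *)

Require Import Defs.
From HB Require Import structures.
From mathcomp Require Import all_boot all_order all_algebra.
From mathcomp Require Import all_classical all_reals all_analysis.
From mathcomp Require Import ring lra.
Set Implicit Arguments.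
Unset Strict Implicit.
Unset Printing Implicit Defensive.
Import Order.TTheory GRing.Theory Num.Theory.
Import numFieldNormedType.Exports.
Local Open Scope classical_set_scope.
Local Open Scope ring_scope.

Lemma finite_absz_lt (M : nat) : finite_set [set p : int | (`|p| < M)%N].
Proof.
have fin : finite_set (Posz @` `I_M `|` Negz @` `I_M).
  by rewrite finite_setU; split; apply: finite_image; exact: finite_II.
apply: sub_finite_set fin => -[n|n] /= nM; [left|right]; exists n => //.
exact: ltnW.
Qed.

(** By the triangle inequality such a [p] satisfies [|p| <= (c + |x|) * q]. *)
Lemma finite_approx_num (R : realType) (x c : R) (q : nat) : (0 < q)%N ->
  finite_set [set p : int | `|x - p%:~R / q%:R| <= c].
Proof.
move=> q0; have q0R : 0 < q%:R :> R by rewrite ltr0n.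
apply: sub_finite_set (finite_absz_lt (Num.bound ((c + `|x|) * q%:R))) => p /= pc.
rewrite -(ltr_nat R); apply: le_lt_trans (archi_boundP _); last first.
  rewrite mulr_ge0 ?ler0n// addr_ge0//; exact: le_trans pc.
have -> : `|p|%N%:R = `|p%:~R| :> R by rewrite -intr_norm natr_absz.
rewrite -ler_pdivrMr// -[X in _ / X]gtr0_norm// -normf_div.
have -> : p%:~R / q%:R = x - (x - p%:~R / q%:R) by ring.
by rewrite (le_trans (ler_normB _ _))// addrC lerD2r.
Qed.

(** Each denominator admits only finitely many numerators, so the pairs with [q < N] cannot exhaust
    an infinite set. *)
Lemma approx_set_large_den (R : realType) (Psi : R -> R) (x : R) (N : nat) :
  approx_set Psi x -> exists p : int, exists2 q : nat,
    (0 < q)%N && (N <= q)%N & `|x - p%:~R / q%:R| <= Psi q%:R.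
Proof.
move=> Wx; apply: contrapT => nex; apply: Wx.
pose A q := [set p : int | (0 < q)%N /\ `|x - p%:~R / q%:R| <= Psi q%:R].
have fin : finite_set (\bigcup_(q in `I_N) ((fun p => (p, q)) @` A q)).
  apply: bigcup_finite => [|q _]; first exact: finite_II.
  (* The positivity condition in [A] makes the slice at [q = 0] empty; since [p / 0 = 0], the
     inequality alone would not bound [p] there. *)
  apply: finite_image; have [->|q0] := posnP q.
    by apply: sub_finite_set (finite_set0 int) => p [].
  by apply: sub_finite_set (finite_approx_num x (Psi q%:R) q0) => p [].
apply: sub_finite_set fin => -[p q] /= [q0 pq].
exists q; last by exists p.
by rewrite /= ltnNge; apply/negP => Nq; apply: nex; exists p, q; rewrite ?q0.
Qed.

(** Common core of both parts, with [Q q] the denominator of the endpoints. The condition [q <= Q q]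
    carries the eventual lower bound over from [q] to [Q q]. *)
Lemma exact_approx_set_eq0 (R : realType) (Psi omega : R -> R) (Q : nat -> nat) :
  (forall q, (0 < q)%N -> (q <= Q q)%N) ->
  (forall q, (0 < q)%N -> 0 < Psi q%:R) ->
  (forall q (p : int) (s : bool), (0 < q)%N -> exists P : int,
     p%:~R / q%:R + (-1) ^+ s * Psi q%:R = P%:~R / (Q q)%:R) ->
  (\forall q \near \oo,
     omega q%:R < (1 - omega (Q q)%:R) / Psi q%:R * Psi (Q q)%:R) ->
  exact_approx_set Psi omega = set0.
Proof.
move=> leQ Psi0 endpoint [N1 _ HN1]; apply/seteqP; split => // x [Wx [N2 _ HN2]].
have [p [q /andP[q0 Nq] pq]] := approx_set_large_den (maxn N1 N2) Wx.
move: Nq; rewrite geq_max => /andP[N1q N2q].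
have /= low := HN2 _ N2q p.
have Psiq := Psi0 _ q0.
have /= := HN1 _ N1q.
rewrite mulrAC ltr_pdivlMr// => om.
(* The boolean serves as sign exponent: the left endpoint is taken exactly when [x] lies left of
   [p/q]. *)
have [P eqP] := endpoint q p (x < p%:~R / q%:R) q0.
have /= := HN2 _ (leq_trans N2q (leQ _ q0)) P.
rewrite -eqP; apply/negP; rewrite -ltNge; apply: le_lt_trans om.
(* The bounds [pq] and [low] together also yield [0 <= omega q * Psi q], used for one of the two
   signs. *)
rewrite ler_norml; case: ltP pq low => [xlt|xge].
- by rewrite ltr0_norm ?subr_lt0// expr1 => *; apply/andP; split; lra.
- by rewrite ger0_norm ?subr_ge0// expr0 => *; apply/andP; split; lra.
Qed.

Theorem theorem1p4 (R : realType) (Psi d e : R -> R)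
    (Psi_pos : pos_fun Psi) (d_pos : pos_fun d) (e_pos : pos_fun e)
    (Psi_de : forall t : R, 0 < t -> Psi t = d t / e t)
    (de_nat : forall q : nat, (0 < q)%N ->
       d q%:R \is a Num.nat /\ e q%:R \is a Num.nat) :
  (forall omega : R -> R, pos_fun omega ->
     (\forall q \near \oo, omega q%:R <
        (1 - omega (q%:R * e q%:R)) / Psi q%:R * Psi (q%:R * e q%:R)) ->
     exact_approx_set Psi omega = set0) /\
  ((forall q : nat, (0 < q)%N ->
      exists2 n : nat, e q%:R = n%:R & (n = 0 %[mod q])%N) ->
   forall omega : R -> R, pos_fun omega ->
     (\forall q \near \oo, omega q%:R <
        (1 - omega (e q%:R)) / Psi q%:R * Psi (e q%:R)) ->
     exact_approx_set Psi omega = set0).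
Proof.
have Psi0 q : (0 < q)%N -> 0 < Psi q%:R by move=> q0; rewrite Psi_pos ?ltr0n.
have de q : (0 < q)%N -> exists D E : nat,
    [/\ (0 < E)%N, e q%:R = E%:R & Psi q%:R = D%:R / E%:R].
  move=> q0; have [/natrP[D dD] /natrP[E eE]] := de_nat _ q0.
  exists D, E; split=> //; last by rewrite Psi_de ?ltr0n// dD eE.
  by rewrite -(ltr0n R) -eE e_pos ?ltr0n.
split=> [omega _ Homega|ediv omega _ Homega].
(* [Num.trunc] only recovers the natural number that [e q] already is for [q > 0]. *)
- apply: (@exact_approx_set_eq0 _ _ _ (fun q => q * Num.trunc (e q%:R))%N) => //.
  + by move=> q /de[D [E [E0 -> _]]]; rewrite natrK leq_pmulr.
  + move=> q p s q0; have [D [E [E0 -> ->]]] := de _ q0; rewrite natrK.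
    (* Numerator of [p/q +- D/E] over the denominator [q * E]. *)
    exists (p * E%:Z + (-1) ^+ s * (D%:Z * q%:Z)).
    rewrite /= natrM !(rmorphD, rmorphM, rmorph_sign)/=.
    by field; rewrite !pnatr_eq0 -!lt0n q0 E0.
  + near=> q; have q0 : (0 < q)%N by near: q; exact: nbhs_infty_gt.
    have [D [E [_ eE _]]] := de _ q0; rewrite /= eE natrK natrM -eE.
    by near: q.
- apply: (@exact_approx_set_eq0 _ _ _ (fun q => Num.trunc (e q%:R))) => //.
  (* A positive multiple of [q] is at least [q]. *)
  + move=> q q0; have [D [E [E0 eE _]]] := de _ q0.
    have [n en n0] := ediv _ q0; rewrite en natrK dvdn_leq//.
      by rewrite -(ltr0n R) -en eE ltr0n.
    by rewrite /dvdn n0 mod0n.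
  + move=> q p s q0; have [D [E [E0 eE ->]]] := de _ q0.
    have [n en n0] := ediv _ q0.
    have nE : n = E by apply/eqP; rewrite -(eqr_nat R) -en eE.
    have /dvdnP[k Ek] : (q %| E)%N by rewrite /dvdn -nE n0 mod0n.
    move: E0; rewrite eE natrK Ek muln_gt0 => /andP[k0 _].
    (* Since [E = k * q], the fraction [p/q] equals [p * k / E], so [E] is already a common
       denominator. *)
    exists (p * k%:Z + (-1) ^+ s * D%:Z).
    rewrite /= natrM !(rmorphD, rmorphM, rmorph_sign)/=.
    by field; rewrite !pnatr_eq0 -!lt0n q0 k0.
  + near=> q; have q0 : (0 < q)%N by near: q; exact: nbhs_infty_gt.
    have [D [E [_ eE _]]] := de _ q0; rewrite /= eE natrK -eE.
    by near: q.
Unshelve. all: by end_near.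
Qed.
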